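(* Let $X_i=\mu+\sigma_ie_i$, $i=1,\ldots,n$, be a modulated stationary process for which the strong invariance principle holds with $\Delta_n=n^{1/4}\log(n)$, i.e. there are standard Brownian motions $\{B_t\}$, $\{B_t^*\}$ with $$\max_{1\le i\le n}|S_i-\tau B_i|=o_{\mathrm{a.s.}}(\Delta_n)\quad\text{and}\quad \max_{1\le i\le n}|S_i^*-\tau^*B_i^*|=o_{\mathrm{a.s.}}(\Delta_n).$$ Assume $$\delta_n=\frac{r_n\Delta_n}{\Sigma_n}+\frac{r_n^*\Delta_n+\Sigma_n^{*2}}{\Sigma_n^2}\to0.$$ Then, as $n\to\infty$, $$\frac{n(\bar X-\mu)}{\underline{V}_n}\Rightarrow N(0,\tau^2).$$ Consequently, if $\hat\tau$ is a consistent estimate of $\tau$, then $\bar X\pm z_{\alpha/2}\hat\tau\,\underline{V}_n/n$ is an asymptotic $(1-\alpha)$ confidence interval for $\mu$ (i.e. its coverage probability tends to $1-\alpha$), where $\alpha\in(0,1)$ and $z_{\alpha/2}$ is the $(1-\alpha/2)$ standard normal quantile.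
   Context: Setting: $\{e_i\}$ is a stationary time series with $E(e_i)=0$, $E(e_i^2)=1$; $\mu\in\mathbb{R}$ is a constant; $\sigma_i>0$ are deterministic constants (which may depend on $n$). $S_i=\sum_{j=1}^ie_j$, $S_i^*=\sum_{j=1}^i(e_j^2-1)$. $\tau^2$ and $\tau^{*2}$ are the long-run variances of $\{e_i\}$ and $\{e_i^2-1\}$ (assumed well defined), where the long-run variance of a stationary process with autocovariances $\gamma_k$ is $\gamma_0+2\sum_{k\ge1}\gamma_k$; it is assumed that $\tau^2>0$, and $\tau>0$, $\tau^*\ge0$ are the square roots. Strong invariance principles are understood on a possibly enlarged probability space on which the process is redefined without changing its distribution; the two Brownian motions may be defined on different probability spaces. Notation: $\bar X=n^{-1}\sum_{i=1}^nX_i$, $\underline{V}_n^2=\sum_{i=1}^n(X_i-\bar X)^2$; $r_n=|\sigma_n|+\sum_{i=2}^n|\sigma_i-\sigma_{i-1}|$, $r_n^*=|\sigma_n^2|+\sum_{i=2}^n|\sigma_i^2-\sigma_{i-1}^2|$; $\Sigma_n^2=\sum_{i=1}^n\sigma_i^2$, $\Sigma_n^{*2}=\bigl(\sum_{i=1}^n\sigma_i^4\bigr)^{1/2}$. $\Rightarrow$ denotes convergence in distribution. *)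

(* Defs.v *)
From HB Require Import structures.
From mathcomp Require Import all_boot all_order all_algebra.
From mathcomp Require Import all_classical all_reals all_analysis.
From mathcomp Require Import measurable_realfun.

Set Implicit Arguments.
Unset Strict Implicit.
Unset Printing Implicit Defensive.
Import Order.TTheory GRing.Theory Num.Theory.
Import numFieldNormedType.Exports.
Local Open Scope classical_set_scope.
Local Open Scope ring_scope.

(* Time series and rows of triangular arrays are functions of an index i : nat
   of which only the values at i >= 1 matter. *)

Section processes.
Context {R : realType}.

(* Equality of all finite-dimensional distributions, i.e. of the laws of the
   vectors (X_1, ..., X_m) and (Y_1, ..., Y_m) on R^m for every m. *)
Definition same_law d1 (T1 : measurableType d1) (P1 : probability T1 R)
    (X : nat -> {RV P1 >-> R}) d2 (T2 : measurableType d2)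
    (P2 : probability T2 R) (Y : nat -> {RV P2 >-> R}) : Prop :=
  forall (m : nat) (A : set (m.-tuple R)), measurable A ->
    P1 [set w | A [tuple X i.+1 w | i < m]] =
    P2 [set w | A [tuple Y i.+1 w | i < m]].

Context d (T : measurableType d) (P : probability T R).

Definition stationary (X : nat -> {RV P >-> R}) : Prop :=
  forall k, same_law X (fun i => X (i + k)%N).

Definition autocov (X : nat -> T -> R) (k : nat) : R :=
  fine (covariance P (X 1%N) (X k.+1)).

Definition long_run_variance_defined (X : nat -> T -> R) : Prop :=
  (forall i, (0 < i)%N -> X i \in Lfun P 2%:E) /\
  cvgn (series (fun k => autocov X k.+1)).

Definition long_run_variance (X : nat -> T -> R) : R :=
  autocov X 0 + 2 * limn (series (fun k => autocov X k.+1)).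

Definition centered_square (x : R) : R := x ^+ 2 - 1.

(* Independence is only required along nondecreasing times; sqrt (t - s) is the
   standard deviation parameter of [normal_prob]. *)
Definition brownian_motion (B : R -> {RV P >-> R}) : Prop :=
  [/\ {ae P, forall w, B 0 w = 0},
      (forall s t : R, 0 <= s -> s < t ->
        forall A : set R, measurable A ->
        P [set w | A (B t w - B s w)] = normal_prob 0 (Num.sqrt (t - s)) A),
      (forall (k : nat) (t : nat -> R) (A : nat -> set R),
        0 <= t 0%N -> (forall i, t i <= t i.+1) ->
        (forall i, measurable (A i)) ->
        P (\bigcap_(i in `I_k) [set w | A i (B (t i.+1) w - B (t i) w)]) =
        (\prod_(i < k) P [set w | A i (B (t i.+1) w - B (t i) w)%R])%E) &
      {ae P, forall w, {within `[0, +oo[, continuous (fun t => B t w)}}].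

Definition partial_sum (X : nat -> T -> R) (i : nat) (w : T) : R :=
  \sum_(1 <= j < i.+1) X j w.

End processes.

Definition Delta {R : realType} (n : nat) : R := n%:R `^ (4^-1) * ln n%:R.

(* Strong invariance principle with rate a for the partial sums of g(e_j): on
   some probability space there are a copy e' of e and a standard Brownian
   motion B with max_(1 <= i <= n) |sum_(j <= i) g(e'_j) - tau B_i| = o_as(a_n). *)
Definition strong_invariance_principle {R : realType} d (T : measurableType d)
    (P : probability T R) (e : nat -> {RV P >-> R}) (g : R -> R) (tau : R)
    (a : nat -> R) : Prop :=
  exists (d' : measure_display) (T' : measurableType d')
    (P' : probability T' R) (e' : nat -> {RV P' >-> R})
    (B : R -> {RV P' >-> R}),
  [/\ same_law e e', brownian_motion B &
      {ae P', forall w,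
        (\big[Num.max/0]_(1 <= i < n.+1)
            `|partial_sum (fun j => g \o e' j) i w - tau * B i%:R w|) / a n
          @[n --> \oo] --> (0 : R)}].

Section scales.
Context {R : realType}.
Implicit Types s : nat -> R.

Definition r_ s (n : nat) : R :=
  `|s n| + \sum_(2 <= i < n.+1) `|s i - s i.-1|.

Definition r_star s (n : nat) : R :=
  `|s n ^+ 2| + \sum_(2 <= i < n.+1) `|s i ^+ 2 - s i.-1 ^+ 2|.

Definition Sigma2 s (n : nat) : R := \sum_(1 <= i < n.+1) s i ^+ 2.

Definition Sigma s (n : nat) : R := Num.sqrt (Sigma2 s n).

(* The square Sigma_n^{*2}, not its root. *)
Definition Sigma_star2 s (n : nat) : R :=
  Num.sqrt (\sum_(1 <= i < n.+1) s i ^+ 4).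

Definition delta s (n : nat) : R :=
  r_ s n * Delta n / Sigma s n +
  (r_star s n * Delta n + Sigma_star2 s n) / Sigma2 s n.

End scales.

Section statistics.
Context {R : realType} d (T : measurableType d) (P : probability T R).

Definition modulated (mu : R) (s : nat -> R) (e : nat -> {RV P >-> R})
  (i : nat) (w : T) : R := mu + s i * e i w.

Let measurable_modulated mu s e i : measurable_fun setT (modulated mu s e i).
Proof. by apply: measurable_funD => //; exact: measurable_funM. Qed.

HB.instance Definition _ mu s e i := isMeasurableFun.Build _ _ _ _
  (modulated mu s e i) (measurable_modulated mu s e i).

Definition sample_mean (X : nat -> {RV P >-> R}) (n : nat) (w : T) : R :=
  (\sum_(1 <= i < n.+1) X i w) / n%:R.

Let measurable_sample_mean X n : measurable_fun setT (sample_mean X n).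
Proof. by apply: measurable_funM => //; exact: measurable_sum. Qed.

HB.instance Definition _ X n := isMeasurableFun.Build _ _ _ _
  (sample_mean X n) (measurable_sample_mean X n).

Definition V_ (X : nat -> {RV P >-> R}) (n : nat) (w : T) : R :=
  Num.sqrt (\sum_(1 <= i < n.+1) (X i w - sample_mean X n w) ^+ 2).

Let measurable_V_ X n : measurable_fun setT (V_ X n).
Proof.
apply: (measurableT_comp (continuous_measurable_fun (@sqrt_continuous R))).
by apply: measurable_sum => i; apply: measurable_funX; exact: measurable_funB.
Qed.

HB.instance Definition _ X n := isMeasurableFun.Build _ _ _ _
  (V_ X n) (measurable_V_ X n).

(* Where V_ vanishes the quotient is 0 by the convention x / 0 = 0. *)
Definition pivot (mu : R) (X : nat -> {RV P >-> R}) (n : nat) (w : T) : R :=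
  n%:R * (sample_mean X n w - mu) / V_ X n w.

Let measurable_pivot mu X n : measurable_fun setT (pivot mu X n).
Proof.
apply: measurable_funM.
  by apply: measurable_funM => //; exact: measurable_funB.
rewrite (_ : (fun w => (V_ X n w)^-1) = (fun w => V_ X n w `^ -1)).
  exact: measurableT_comp (measurable_powR _) _.
by apply/funext => w; rewrite powR_inv1// sqrtr_ge0.
Qed.

HB.instance Definition _ mu X n := isMeasurableFun.Build _ _ _ _
  (pivot mu X n) (measurable_pivot mu X n).

Definition confidence_interval (z : R) (tau_hat : T -> R)
    (X : nat -> {RV P >-> R}) (n : nat) (w : T) : interval R :=
  let h := z * tau_hat w * V_ X n w / n%:R in
  `[sample_mean X n w - h, sample_mean X n w + h].

Definition cvg_in_probability (Y : nat -> {RV P >-> R}) (c : R) : Prop :=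
  forall eps : R, 0 < eps ->
    P [set w | eps <= `|Y n w - c|] @[n --> \oo] --> 0%E.

(* Convergence of the distribution functions at every continuity point of the
   distribution function of the limit law Q. *)
Definition cvg_in_distribution (Y : nat -> {RV P >-> R})
    (Q : probability (measurableTypeR R) R) : Prop :=
  forall x : R, {for x, continuous (fun y : R => Q `]-oo, y]%classic)} ->
    cdf (Y n) x @[n --> \oo] --> Q `]-oo, x]%classic.

End statistics.

(* The generalized inverse of the distribution function of Q. *)
Definition quantile {R : realType} (Q : probability (measurableTypeR R) R) (p : R) : R :=
  inf [set x : R | (p%:E <= Q `]-oo, x]%classic)%E].

(* Main.v *)
Require Import Defs.
From HB Require Import structures.
From mathcomp Require Import all_boot all_order all_algebra.
From mathcomp Require Import all_classical all_reals all_analysis.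
From mathcomp Require Import measurable_realfun ring lra.

(** Divide numerator and denominator of the pivot by Sigma_n. The numerator
becomes W_n, the sum of the sigma_i e_i over Sigma_n, and the denominator
Q_n = V_n / Sigma_n; then W_n tends to N(0, tau^2) in law and Q_n to 1 in
probability.

Both limits are statements on weighted sums of g(e_i), with g the identity or
x^2 - 1. Since the law of such a sum depends only on the law of (e_1, ..., e_n),
the sum may be taken on the space of the strong invariance principle. There,
summation by parts replaces the partial sums of the g(e_i) by tau B_i at the
cost of at most r_n times the maximal error ([gaussian_approximation]), and the
weighted sum of Brownian increments which remains is exactly normal, with
variance the sum of the squared weights ([brownian_weighted_sum_law]). If that
variance is 1, the weighted sum has the limit law N(0, tau^2) ([weighted_clt]);
if it tends to 0, so does the weighted sum ([weighted_lln]).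

The first case applies to W_n. For Q_n, expanding the empirical variance gives
[[
Q_n^2 = 1 + sum_i (sigma_i^2 / Sigma_n^2) (e_i^2 - 1) - (W_n / sqrt n)^2
]]
and the second case applies to both error terms ([studentizer_sqr]); the
assumption delta_n -> 0 is what makes the replacement errors and the variance of
the first of them vanish.

The conclusions follow from Slutsky's lemma in the form [squeeze_probability]:
the pivot is at most x iff W_n <= x Q_n, and mu lies in the interval iff
|W_n| <= z tau_hat Q_n, where x Q_n and z tau_hat Q_n tend in probability to x
and z tau. The second event has limit probability 2 Phi(z) - 1 = 1 - alpha. *)

Set Implicit Arguments.
Unset Strict Implicit.
Unset Printing Implicit Defensive.
Import Order.TTheory GRing.Theory Num.Theory.
Import numFieldNormedType.Exports.
Local Open Scope classical_set_scope.
Local Open Scope ring_scope.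

(** * Normal distribution functions *)

Section normal_law.
Context {R : realType}.
Notation leb := (@lebesgue_measure R).

(** Both sides are measures in [A] that agree on the intervals ]x, y]. *)
Lemma lebesgue_measure_scale (a : R) (A : set (measurableTypeR R)) :
  a != 0 -> measurable A ->
  leb A = (`|a|%:E * leb [set x | A (a * x)%R])%E.
Proof.
move=> a0 mA.
pose f : measurableTypeR R -> measurableTypeR R := fun x => a * x.
have mf : measurable_fun setT f by exact: measurable_funM.
pose c : {nonneg R} := NngNum (normr_ge0 a).
(* the measure structure of the pushforward depends on the measurability of f *)
pose nu0 : {measure set (measurableTypeR R) -> \bar R} := mscale c (pushforward leb f).
pose nu := nu0 mf.
have -> : (`|a|%:E * leb [set x | A (a * x)%R])%E = nu A by [].
apply: lebesgue_measure_unique => // X [[x y]] _ <-.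
have -> : nu `]x, y]%classic = (`|a|%:E * leb (f @^-1` `]x, y]))%E by [].
have [ap|an|] := ltrgtP 0 a; last by move=> a00; rewrite -a00 eqxx in a0.
  have -> : f @^-1` `]x, y]%classic = `](x/a), (y/a)]%classic.
    apply/seteqP; split => w; rewrite /f /= !in_itv/= ltr_pdivrMr// ler_pdivlMr//;
      by rewrite (mulrC w).
  rewrite !lebesgue_measure_itv /= !lte_fin ltr_pM2r ?invr_gt0//.
  case: ifP => // _; last by rewrite mule0.
  by rewrite -!EFinD -EFinM gtr0_norm// -mulrBl mulrC divfK.
have -> : f @^-1` `]x, y]%classic = `[(y/a), (x/a)[%classic.
  apply/seteqP; split => w; rewrite /f /= !in_itv/= ltr_ndivlMr// ler_ndivrMr//;
    by rewrite (mulrC w) andbC.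
rewrite !lebesgue_measure_itv /= !lte_fin ltr_nM2r ?invr_lt0//.
case: ifP => // _; last by rewrite mule0.
by rewrite -!EFinD -EFinM ltr0_norm// -mulrBl mulNr mulrC divfK// opprB.
Qed.

(** If N is N(0, s^2) then a N is N(0, (a s)^2): change of variables in the
density. The case a = -1 is the symmetry of the normal law. *)
Lemma normal_prob_scale (a s : R) (A : set (measurableTypeR R)) :
  a != 0 -> s != 0 -> measurable A ->
  normal_prob 0 s [set x | A (a * x)] = normal_prob 0 (`|a| * s) A.
Proof.
move=> a0 s0 mA; rewrite /normal_prob.
pose f : measurableTypeR R -> measurableTypeR R := fun x => a * x.
have mf : measurable_fun setT f by exact: measurable_funM.
have as0 : `|a| * s != 0 by rewrite mulf_neq0 ?normr_eq0.
have pdfE x : (normal_pdf 0 s x)%:E =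
    (`|a|%:E * ((normal_pdf 0 (`|a| * s) (f x))%:E))%E.
  rewrite -EFinM !normal_pdfE// /normal_peak /normal_fun !subr0 /f.
  rewrite !exprMn real_normK ?num_real// -2!mulrnAr.
  rewrite -[a ^+ 2 * _ * _]mulrA (sqrtrM _ (sqr_ge0 a)).
  rewrite sqrtr_sqr invfM 2!mulrA divff ?normr_eq0// mul1r.
  congr (_ * expR _)%:E; rewrite -mulrnAr; field.
  by rewrite s0 a0.
have pdf_ge0 t x : (0 <= (normal_pdf 0 t x)%:E)%E.
  by rewrite lee_fin normal_pdf_ge0.
have mpdf t D :
    measurable_fun D (fun x : measurableTypeR R => (normal_pdf 0 t x)%:E).
  by apply/measurable_EFinP/measurable_funTS; exact: measurable_normal_pdf.
have mfA : measurable (f @^-1` A).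
  by rewrite -[X in measurable X]setTI; exact: mf.
transitivity (`|a|%:E * \int[pushforward leb f]_(y in A)
    (normal_pdf 0 (`|a| * s) y)%:E)%E.
  rewrite ge0_integral_pushforward//.
  rewrite -ge0_integralZl//.
  - by apply: eq_integral => x _; exact: pdfE.
  - apply: measurable_funTS.
    exact: (measurableT_comp (mpdf (`|a| * s) setT) mf).
  - by move=> x _; exact: pdf_ge0.
rewrite -(@ge0_integral_mscale _ _ _ _ _ mA (NngNum (normr_ge0 a)))//.
by apply: eq_measure_integral => B mB _; exact/esym/lebesgue_measure_scale.
Qed.

Definition normal_cdf (s x : R) : R := fine (normal_prob 0 s `]-oo, x]%classic).

Lemma normal_cdfE s x : normal_prob 0 s `]-oo, x]%classic = (normal_cdf s x)%:E.
Proof. by rewrite fineK// fin_num_measure. Qed.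

Lemma normal_cdfB s x y : x <= y ->
  normal_prob 0 s `]x, y]%classic = (normal_cdf s y - normal_cdf s x)%:E.
Proof.
move=> xy; rewrite EFinB -!normal_cdfE.
have -> : `]-oo, y]%classic = `]-oo, x]%classic `|` `]x, y]%classic.
  apply/seteqP; split => w /=; rewrite !in_itv/=.
    by case: (leP w x); [left|right].
  by case=> [/le_trans->//|/andP[]].
rewrite measureU//.
  by rewrite addeAC subee ?add0e// fin_num_measure.
by apply/seteqP; split => // w [] /=; rewrite !in_itv/= => wx /andP[]; rewrite ltNge wx.
Qed.

Lemma normal_cdf_le s x y : x <= y -> normal_cdf s x <= normal_cdf s y.
Proof.
by move=> xy; rewrite -subr_ge0 -lee_fin -normal_cdfB.
Qed.

(** The normal density is bounded by its peak. *)
Lemma normal_cdf_lipschitz s x y : s != 0 -> x <= y ->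
  normal_cdf s y - normal_cdf s x <= normal_peak s * (y - x).
Proof.
move=> s0 xy; rewrite -lee_fin -normal_cdfB// /normal_prob.
apply: (@le_trans _ _ (\int[leb]_(z in `]x, y]%classic) (normal_peak s)%:E)%E).
  apply: ge0_le_integral => //=.
  - by move=> z _; rewrite lee_fin normal_pdf_ge0.
  - by apply/measurable_EFinP/measurable_funTS; exact: measurable_normal_pdf.
  - by move=> z _; rewrite lee_fin normal_pdf_ub.
rewrite integral_cst//= lebesgue_measure_itv/= lte_fin.
case: ltP => [_|yx]; rewrite ?EFinM ?EFinB// mule0 lee_fin.
by rewrite mulr_ge0 ?normal_peak_ge0// subr_ge0.
Qed.

Lemma continuous_normal_cdf s : s != 0 -> continuous (normal_cdf s).
Proof.
move=> s0 x; apply/cvgrPdist_lt => /= eps eps0.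
have c0 := normal_peak_gt0 s0.
near=> y.
have xy : `|x - y| < eps / normal_peak s.
  by near: y; apply: cvgr_dist_lt; rewrite // divr_gt0.
apply: (@le_lt_trans _ _ (normal_peak s * `|x - y|)).
  case: (leP x y) => [|/ltW] h; last first.
    by rewrite !ger0_norm ?subr_ge0 ?normal_cdf_le// normal_cdf_lipschitz.
  rewrite distrC [in leRHS]distrC !ger0_norm ?subr_ge0 ?normal_cdf_le//.
  exact: normal_cdf_lipschitz.
by rewrite mulrC -ltr_pdivlMr.
Unshelve. all: by end_near. Qed.

Lemma normal_cdf_scale (a s x : R) : 0 < a -> s != 0 ->
  normal_cdf (a * s) (a * x) = normal_cdf s x.
Proof.
move=> a0 s0.
have := @normal_prob_scale a s `]-oo, a * x]%classic
  (lt0r_neq0 a0) s0 (measurable_itv _).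
rewrite (gtr0_norm a0) /normal_cdf => <-.
suff -> : [set y | `]-oo, (a * x)]%classic (a * y)] = `]-oo, x]%classic by [].
by apply/seteqP; split => w /=; rewrite !in_itv/= ler_pM2l.
Qed.

(** The law is symmetric and the point x carries no mass. *)
Lemma normal_cdfN (s x : R) : s != 0 -> normal_cdf s (- x) = 1 - normal_cdf s x.
Proof.
move=> s0.
have itvU : [set: R] = `]-oo, x]%classic `|` `]x, +oo[%classic.
  by rewrite -setCitvl setUv.
have xE : normal_prob 0 s `]x, +oo[%classic = (normal_cdf s (- x))%:E.
  rewrite -normal_cdfE -[in RHS](mul1r s) -(@normrN1 R).
  rewrite -normal_prob_scale ?oppr_eq0//.
  have -> : [set y | `]-oo, (- x)]%classic (-1 * y)] =
      [set x] `|` `]x, +oo[%classic.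
    rewrite setU1itv//; apply/seteqP; split => w /=;
      by rewrite !in_itv/= andbT mulN1r lerN2.
  rewrite measureU//.
    suff sx : normal_prob 0 s [set x] = 0%E.
      by rewrite [X in _ = (X + _)%E]sx add0e.
    have /null_content_dominatesP := @normal_prob_dominates R 0 s.
    by apply => //; exact: lebesgue_measure_set1.
  by apply/seteqP; split => // w [] /= ->; rewrite in_itv/= ltxx.
suff : (normal_cdf s x + normal_cdf s (- x))%:E = 1%E.
  by move=> [<-]; rewrite addrC addKr.
rewrite EFinD -xE -normal_cdfE -measureU//; last by rewrite -setCitvl setICr.
by rewrite -itvU; exact: (@probability_setT _ _ _ (normal_prob 0 s)).
Qed.

Lemma normal_tail_le (s c : R) : s != 0 ->
  fine (normal_prob 0 s [set x : R | c <= `|x|]) <= 2 * normal_cdf s (- c).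
Proof.
move=> s0; pose Q := normal_prob 0 s.
have -> : [set x : R | c <= `|x|] = `]-oo, (- c)]%classic `|` `[c, +oo[%classic.
  apply/seteqP; split => x /=; rewrite !in_itv/= andbT ler_normr (lerNr c).
    by case/orP; [right|left].
  by case=> ->; rewrite ?orbT.
have cy : Q `[c, +oo[%classic = (normal_cdf s (- c))%:E.
  rewrite -normal_cdfE -[in RHS](mul1r s) -(@normrN1 R).
  rewrite -normal_prob_scale ?oppr_eq0//.
  suff -> : [set y | `]-oo, (- c)]%classic (-1 * y)] = `[c, +oo[%classic by [].
  by apply/seteqP; split => w /=; rewrite !in_itv/= andbT mulN1r lerN2.
have : (Q (`]-oo, (- c)%R]%classic `|` `[c, +oo[%classic) <=
    Q `]-oo, (- c)%R]%classic + Q `[c, +oo[%classic)%E.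
  exact: measureU2.
rewrite cy [Q `]-oo, _]%classic]normal_cdfE -EFinD => Qle.
rewrite -lee_fin fineK ?fin_num_measure//; first by rewrite mulr_natl mulr2n.
exact: measurableU.
Qed.

(* the identity as a random variable, whose law under a probability Q is Q *)
Let idR : measurableTypeR R -> R := fun x => x.
Let measurable_idR : measurable_fun setT idR. Proof. exact: measurable_id. Qed.
HB.instance Definition _ := isMeasurableFun.Build _ _ _ _ idR measurable_idR.

Lemma normal_cdf_cvgy s : normal_cdf s x @[x --> +oo] --> (1 : R).
Proof.
apply/fine_cvg.
exact: (@cvg_cdfy1 _ _ R (normal_prob 0 s) idR).
Qed.

Lemma normal_cdf_cvgNy s : normal_cdf s x @[x --> -oo] --> (0 : R).
Proof.
apply/fine_cvg.
exact: (@cvg_cdfNy0 _ _ R (normal_prob 0 s) idR).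
Qed.

(** The distribution function is continuous and takes values below and above
p, so it takes the value p at the infimum of the points where it is at least
p. *)
Lemma normal_cdf_quantile (s p : R) : s != 0 -> 0 < p < 1 ->
  normal_cdf s (quantile (normal_prob 0 s) p) = p.
Proof.
move=> s0 /andP[p0 p1]; rewrite /quantile; set S := [set x | _].
have SE x : S x <-> p <= normal_cdf s x by rewrite /S/= normal_cdfE lee_fin.
have S0 : S !=set0.
  have /cvgrPdist_lt/(_ (1 - p)) := @normal_cdf_cvgy s.
  rewrite subr_gt0 => /(_ p1)[M [Mreal hM]]; exists (M + 1).
  have := hM (M + 1); rewrite ltrDl ltr01 => /(_ isT) /= h.
  by apply/SE; have := ler_norm (1 - normal_cdf s (M + 1)); lra.
have lbS : has_lbound S.
  have /cvgrPdist_lt/(_ p p0)[M [Mreal hM]] := @normal_cdf_cvgNy s.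
  exists (M - 1) => x /SE px; rewrite leNgt; apply/negP => xM.
  have := hM (M - 1); rewrite ltrBlDr ltrDl ltr01 => /(_ isT) /= h.
  have := normal_cdf_le s (ltW xM); have := ler_norm (- (0 - normal_cdf s (M - 1))).
  by rewrite normrN; lra.
have cq : normal_cdf s x @[x --> inf S] --> normal_cdf s (inf S).
  exact: continuous_normal_cdf.
apply/eqP; rewrite eq_le; apply/andP; split; rewrite leNgt; apply/negP => pq.
  have [e /= e0 he] := cvgr_gt _ cq _ pq.
  have := he (inf S - e / 2); rewrite /= opprB addrC subrK gtr0_norm ?divr_gt0//.
  rewrite ltr_pdivrMr// ltr_pMr// ltr1n => /(_ isT) pc.
  have := ge_inf lbS (proj2 (SE _) (ltW pc)).
  by rewrite lerBrDr gerDl leNgt divr_gt0.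
have [e /= e0 he] := cvgr_lt _ cq _ pq.
have [x /SE px xe] := inf_adherent e0 (conj S0 lbS).
have qx := ge_inf lbS (proj2 (SE _) px).
have := he x; rewrite /= distrC ger0_norm ?subr_ge0// ltrBlDl => /(_ xe).
by rewrite ltNge px.
Qed.

End normal_law.

(** * Weighted sums of Brownian increments *)

Section tuple_laws.
Context {R : realType}.

Let rectangles (n : nat) : set (set (n.-tuple R)) :=
  [set A | exists2 C : nat -> set R, (forall i, measurable (C i)) &
     A = [set t | forall i : 'I_n, C i (tnth t i)]].

Let rectangles_setI n : setI_closed (@rectangles n).
Proof.
move=> _ _ [C mC ->] [D mD ->]; exists (fun i => C i `&` D i).
  by move=> i; exact: measurableI.
by apply/seteqP; split=> [t [] ? ? i|t h]; [split|split=> i; have [] := h i].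
Qed.

Let measurable_rectangles n :
  @measurable _ (n.-tuple R) = <<s @rectangles n >>.
Proof.
apply/seteqP; split.
  apply: smallest_sub; first exact: smallest_sigma_algebra.
  move=> A.
  rewrite -bigcup_seq/= => -[i _ [C mC <-]].
  apply: sub_sigma_algebra.
  exists (fun j : nat => if j == i :> nat then C else setT).
    by move=> j; case: ifP.
  apply/seteqP; split=> [t [_ Ct] j|t /(_ i)]; rewrite ?eqxx//.
  by case: eqP => // /val_inj ->.
apply: smallest_sub; first exact: sigma_algebra_measurable.
move=> _ [C mC ->].
rewrite (_ : [set t | _] =
  \bigcap_(i in [set: 'I_n]) ((@tnth n R)^~ i @^-1` C i)).
  apply: fin_bigcap_measurable => // i _.
  by rewrite -[X in measurable X]setTI; exact: measurable_tnth.
by apply/seteqP; split=> [t h i _|t h i]; exact: h.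
Qed.

(** A law on R^n is determined by its values on products of Borel sets, which
form a generating class stable under intersection. *)
Lemma eq_tuple_law d1 (T1 : measurableType d1) (P1 : probability T1 R)
    d2 (T2 : measurableType d2) (P2 : probability T2 R)
    (X : nat -> T1 -> R) (Y : nat -> T2 -> R) (n : nat) :
  (forall i, measurable_fun setT (X i)) ->
  (forall i, measurable_fun setT (Y i)) ->
  (forall C : nat -> set R, (forall i, measurable (C i)) ->
     P1 (\bigcap_(i in `I_n) [set w | C i (X i w)]) =
     P2 (\bigcap_(i in `I_n) [set w | C i (Y i w)])) ->
  forall A : set (n.-tuple R), measurable A ->
    P1 [set w | A [tuple X i w | i < n]] = P2 [set w | A [tuple Y i w | i < n]].
Proof.
move=> mX mY XY A mA.
have mtX : measurable_fun setT (fun w => [tuple X i w | i < n]).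
  apply/measurable_fun_tnthP => i.
  by apply: (eq_measurable_fun (X i)) => // w _ /=; rewrite tnth_mktuple.
have mtY : measurable_fun setT (fun w => [tuple Y i w | i < n]).
  apply/measurable_fun_tnthP => i.
  by apply: (eq_measurable_fun (Y i)) => // w _ /=; rewrite tnth_mktuple.
pose tX : {mfun T1 >-> n.-tuple R} := mfun_Sub (mem_set mtX).
pose tY : {mfun T2 >-> n.-tuple R} := mfun_Sub (mem_set mtY).
apply: (measure_unique (@rectangles n) (fun=> setT) (@measurable_rectangles n)
  (@rectangles_setI n) _ _ (distribution P1 tX) (distribution P2 tY)) => //.
- by move=> _; exists (fun=> setT) => //; apply/seteqP; split.
- by rewrite bigcup_const.
- move=> _ [C mC ->]; have := XY C mC.
  rewrite /distribution/pushforward/=.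
  congr (_ = _); congr (_ _); apply/seteqP; split => w /= h i.
  + by rewrite tnth_mktuple; apply: h => /=.
  + by move=> /= ni; have := h (Ordinal ni); rewrite tnth_mktuple.
  + by rewrite tnth_mktuple; apply: h => /=.
  + by move=> /= ni; have := h (Ordinal ni); rewrite tnth_mktuple.
- move=> _; apply: (le_lt_trans (@probability_le1 _ _ _ (distribution P1 tX) _ _)).
    exact: measurableT.
  by rewrite ltry.
Qed.

Lemma measurable_sum_tuple n :
  measurable_fun setT (fun t : n.-tuple R => \sum_(i < n) tnth t i).
Proof. by apply: measurable_sum => i; exact: measurable_tnth. Qed.

End tuple_laws.

Section brownian_sums.
Context {R : realType} d (T : measurableType d) (P : probability T R).
Variable B : R -> {RV P >-> R}.
Hypothesis BB : brownian_motion B.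

Let increment_law_scaled (a : R) (k : nat) (A : set R) : 0 < a -> measurable A ->
  P [set w | A (a * (B k.+1%:R w - B k%:R w))] = normal_prob 0 a A.
Proof.
move=> a0 mA; case: BB => _ lawB _ _.
have mA' : measurable [set x : R | A (a * x)].
  have ma : measurable_fun [set: R] (fun x => a * x) by exact: measurable_funM.
  by rewrite -[X in measurable X]setTI; exact: ma.
have := lawB k%:R k.+1%:R (ler0n _ _) _ _ mA'.
rewrite ltr_nat ltnSn => /(_ isT) /= ->.
rewrite -natr1 addrAC subrr add0r sqrtr1.
by rewrite (normal_prob_scale (lt0r_neq0 a0) (oner_neq0 R) mA) mulr1 gtr0_norm.
Qed.

Let increment_law (a t : R) (A : set R) : 0 < a -> 0 <= t -> measurable A ->
  P [set w | A (B (t + a ^+ 2) w - B t w)] = normal_prob 0 a A.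
Proof.
move=> a0 t0 mA; case: BB => _ lawB _ _.
apply: (etrans (lawB t (t + a ^+ 2) t0 _ A mA)).
  by rewrite ltrDl exprn_gt0.
by rewrite addrAC subrr add0r sqrtr_sqr gtr0_norm.
Qed.

(** The independent variables a_i (B_(i+1) - B_i) have the same joint law as the
increments of the Brownian motion between the times
t_i = a_0^2 + ... + a_(i-1)^2, and the latter increments telescope to
B_(t_n) - B_0. This replaces the computation of convolutions of normal laws. *)
Lemma brownian_weighted_sum_law (a : nat -> R) (n : nat) (A : set R) :
  (0 < n)%N -> (forall i, (i < n)%N -> 0 < a i) -> measurable A ->
  P [set w | A (\sum_(i < n) a i * (B i.+1%:R w - B i%:R w))] =
  normal_prob 0 (Num.sqrt (\sum_(i < n) a i ^+ 2)) A.
Proof.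
move=> n0 a0 mA.
pose t k := \sum_(i < k) a i ^+ 2.
have t0 k : 0 <= t k by apply: sumr_ge0 => i _; exact: sqr_ge0.
have tS k : t k.+1 = t k + a k ^+ 2 by rewrite /t big_ord_recr.
have mS : measurable [set x : n.-tuple R | A (\sum_(i < n) tnth x i)].
  rewrite -[X in measurable X]setTI.
  have := @measurable_sum_tuple R n; apply => //.
have [B0 lawB indB _] := BB.
have := @eq_tuple_law R _ _ P _ _ P (fun i w => a i * (B i.+1%:R w - B i%:R w))
  (fun i w => B (t i.+1) w - B (t i) w) n _ _ _ _ mS.
have -> : [set w | [set x : n.-tuple R | A (\sum_(i < n) tnth x i)]
     [tuple a i * (B i.+1%:R w - B i%:R w) | i < n]] =
  [set w | A (\sum_(i < n) a i * (B i.+1%:R w - B i%:R w))].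
  apply/funext => w /=; congr (A _).
  by apply: eq_bigr => i _; rewrite tnth_mktuple.
have -> : [set w | [set x : n.-tuple R | A (\sum_(i < n) tnth x i)]
     [tuple B (t i.+1) w - B (t i) w | i < n]] =
  [set w | A (B (t n) w - B (t 0%N) w)].
  apply/funext => w /=; congr (A _).
  rewrite -(telescope_sumr (fun i => B (t i) w))// big_mkord.
  by apply: eq_bigr => i _; rewrite tnth_mktuple.
move=> ->.
- have t00 : t 0%N = 0 by rewrite /t big_ord0.
  apply: (etrans (lawB (t 0%N) (t n) (t0 _) _ A mA)); last by rewrite t00 subr0.
  rewrite t00 /t (bigD1 (Ordinal n0))//= ltr_pwDl ?exprn_gt0 ?a0// sumr_ge0// => i _.
  exact: sqr_ge0.
- by move=> i; apply: measurable_funM => //; exact: measurable_funB.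
- by move=> i; exact: measurable_funB.
move=> C mC.
have mC' i : measurable [set x | C i (a i * x)].
  have ma : measurable_fun [set: R] (fun x => a i * x) by exact: measurable_funM.
  by rewrite -[X in measurable X]setTI; exact: ma.
have := indB n (fun i => i%:R) (fun i => [set x | C i (a i * x)]) _ _ mC'.
rewrite /= => ->//; last by move=> i; rewrite ler_nat.
rewrite indB//; last by move=> i; rewrite tS lerDl sqr_ge0.
apply: eq_bigr => i _.
rewrite increment_law_scaled//; last exact: a0.
by rewrite tS increment_law//; exact: a0.
Qed.

End brownian_sums.

(** * Events of vanishing probability *)

Section events.
Context {R : realType} d (T : measurableType d) (P : probability T R).

Lemma measurable_set_le (f g : T -> R) : measurable_fun setT f ->
  measurable_fun setT g -> measurable [set w | f w <= g w].
Proof.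
by move=> mf mg; rewrite -[X in measurable X]setTI; exact: measurable_fun_le.
Qed.

Lemma measurable_set_ge_norm (f : T -> R) (c : R) : measurable_fun setT f ->
  measurable [set w | c <= `|f w|].
Proof.
by move=> mf; apply: measurable_set_le => //; exact: measurableT_comp.
Qed.

Lemma fine_probability_le (A B : set T) : measurable A -> measurable B ->
  A `<=` B -> fine (P A) <= fine (P B).
Proof.
move=> mA mB AB; rewrite fine_le ?fin_num_measure//.
by apply: le_measure; rewrite ?inE.
Qed.

Lemma fine_probabilityU_le (A B : set T) : measurable A -> measurable B ->
  fine (P (A `|` B)) <= fine (P A) + fine (P B).
Proof.
move=> mA mB; rewrite -fineD ?fin_num_measure//.
by rewrite fine_le ?fin_numD ?fin_num_measure//;
  [exact: measurableU|exact: measureU2].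
Qed.

Lemma cvg_fine_probability (A : nat -> set T) (p : R) :
  (forall n, measurable (A n)) ->
  P (A n) @[n --> \oo] --> p%:E <-> fine (P (A n)) @[n --> \oo] --> p.
Proof.
move=> mA; split; first by move/fine_cvgP => -[].
by move=> h; apply/fine_cvgP; split => //; near=> n; rewrite fin_num_measure.
Unshelve. all: by end_near. Qed.

Definition vanishing (E : nat -> set T) : Prop :=
  (forall n, measurable (E n)) /\ fine (P (E n)) @[n --> \oo] --> (0 : R).

Lemma vanishing_sub (E F : nat -> set T) : (forall n, measurable (F n)) ->
  (\forall n \near \oo, F n `<=` E n) -> vanishing E -> vanishing F.
Proof.
move=> mF FE [mE E0]; split => //.
apply: (squeeze_cvgr _ (cvg_cst 0) E0); near=> n.
rewrite fine_ge0//= fine_probability_le//; near: n; exact: FE.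
Unshelve. all: by end_near. Qed.

Lemma vanishingU (E F : nat -> set T) :
  vanishing E -> vanishing F -> vanishing (fun n => E n `|` F n).
Proof.
move=> [mE E0] [mF F0]; split; first by move=> n; exact: measurableU.
apply: (squeeze_cvgr _ (cvg_cst 0)); last by rewrite -(addr0 0); exact: cvgD E0 F0.
by near=> n; rewrite fine_ge0//= fine_probabilityU_le.
Unshelve. all: by end_near. Qed.

(** A form of Slutsky's lemma. Up to an event of vanishing probability, [A n]
lies between the events [W n <= x - eps] and [W n <= x + eps]; their
probabilities tend to G (x - eps) and G (x + eps), and G is continuous at x. *)
Lemma squeeze_probability (W : nat -> T -> R) (G : R -> R) (x : R)
    (A : nat -> set T) :
  (forall n, measurable (A n)) -> (forall n, measurable_fun setT (W n)) ->
  {for x, continuous G} ->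
  (forall y, fine (P [set w | W n w <= y]) @[n --> \oo] --> G y) ->
  (forall eps, 0 < eps -> exists2 E, vanishing E & \forall n \near \oo,
    forall w, ~ E n w ->
      (W n w <= x - eps -> A n w) /\ (A n w -> W n w <= x + eps)) ->
  fine (P (A n)) @[n --> \oo] --> G x.
Proof.
move=> mA mW cG WG sq; apply/cvgrPdist_lt => /= eta eta0.
have eta3 : 0 < eta / 3 by rewrite divr_gt0.
have [e /= e0 eG] := proj1 (cvgrPdist_lt _ _) cG _ eta3.
have e20 : 0 < e / 2 by rewrite divr_gt0.
have e2e : `|e / 2| < e by rewrite gtr0_norm// ltr_pdivrMr// ltr_pMr// ltr1n.
have Gp := eG (x + e / 2); have Gm := eG (x - e / 2).
rewrite /= opprD addrA subrr add0r normrN in Gp.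
rewrite /= opprB addrC subrK in Gm.
have {}Gp := Gp e2e; have {}Gm := Gm e2e.
have [E [mE E0] sE] := sq _ e20.
have mWy n y : measurable [set w | W n w <= y] by exact: measurable_set_le.
near=> n.
have nE : `|0 - fine (P (E n))| < eta / 3.
  by near: n; exact: (proj1 (cvgrPdist_lt _ _) E0).
have np : `|G (x + e / 2) - fine (P [set w | W n w <= x + e / 2])| < eta / 3.
  by near: n; exact: (proj1 (cvgrPdist_lt _ _) (WG _)).
have nm : `|G (x - e / 2) - fine (P [set w | W n w <= x - e / 2])| < eta / 3.
  by near: n; exact: (proj1 (cvgrPdist_lt _ _) (WG _)).
have sEn : forall w, ~ E n w ->
    (W n w <= x - e / 2 -> A n w) /\ (A n w -> W n w <= x + e / 2).
  by near: n.
have h1 : fine (P (A n)) <=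
    fine (P [set w | W n w <= x + e / 2]) + fine (P (E n)).
  apply: le_trans (fine_probabilityU_le _ _) => //.
  apply: fine_probability_le => //; first exact: measurableU.
  by move=> w Aw /=; have [|nEw] := pselect (E n w);
    [right|left; apply: (sEn w nEw).2].
have h2 : fine (P [set w | W n w <= x - e / 2]) <=
    fine (P (A n)) + fine (P (E n)).
  apply: le_trans (fine_probabilityU_le _ _) => //.
  apply: fine_probability_le => //; first exact: measurableU.
  by move=> w Aw /=; have [|nEw] := pselect (E n w);
    [right|left; apply: (sEn w nEw).1].
rewrite sub0r normrN in nE.
move: nE np nm Gp Gm h1 h2; rewrite !ltr_norml.
move: (fine (P (A n))) (fine (P (E n))) (fine _) (fine _) => p q r s.
move=> /andP[? ?] /andP[? ?] /andP[? ?] /andP[? ?] /andP[? ?] ? ?.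
by apply/andP; split; lra.
Unshelve. all: by end_near. Qed.

(** Almost sure convergence implies convergence in probability, by Egorov. *)
Lemma ae_cvg0_vanishing (f : nat -> T -> R) :
  (forall n, measurable_fun setT (f n)) ->
  {ae P, forall w, f n w @[n --> \oo] --> (0 : R)} ->
  forall eps : R, 0 < eps -> vanishing (fun n => [set w | eps <= `|f n w|]).
Proof.
move=> mf f0 eps eps0.
have mE n : measurable [set w | eps <= `|f n w|] by exact: measurable_set_ge_norm.
split => //; apply/cvgrPdist_lt => /= eta eta0.
have fT : {ae P, forall w, [set: T] w -> f ^~ w @ \oo --> (cst 0 : T -> R) w}.
  by apply: filterS f0 => w h _.
have PT : (P [set: T] < +oo)%E by rewrite probability_setT ltry.
have [B [mB PB fB]] := @ae_pointwise_almost_uniform _ R T P f (cst 0) setT eta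
  mf (measurable_cst _) measurableT PT fT eta0.
have unif : \forall n \near \oo, forall w, ([set: T] `\` B) w -> `|f n w| < eps.
  apply: (fB [set h | forall w, ([set: T] `\` B) w -> `|h w| < eps]).
  apply/uniform_nbhs; exists [set xy | ball xy.1 eps xy.2]; split.
    by rewrite -entourage_ballE; exists eps.
  by move=> h hb w /hb; rewrite /ball/= sub0r normrN.
near=> n; rewrite sub0r normrN ger0_norm ?fine_ge0//.
rewrite -lte_fin fineK ?fin_num_measure//; apply: le_lt_trans PB.
apply: le_measure; rewrite ?inE// => w /= efw; apply: contrapT => nBw.
have un : forall v, ([set: T] `\` B) v -> `|f n v| < eps by near: n.
by have := un w (conj I nBw); rewrite ltNge efw.
Unshelve. all: by end_near. Qed.

End events.

(** * Weighted sums under a strong invariance principle *)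

Section weights.
Context {R : realType}.
Implicit Types (a D : nat -> R).

Lemma abel_summation a D n : D 0%N = 0 ->
  \sum_(1 <= i < n.+2) a i * (D i - D i.-1) =
  a n.+1 * D n.+1 - \sum_(2 <= i < n.+2) (a i - a i.-1) * D i.-1.
Proof.
move=> D0; elim: n => [|n IH].
  by rewrite big_nat1 big_geq// D0 !subr0.
rewrite big_nat_recr//= IH [in RHS]big_nat_recr//=; ring.
Qed.

(** The coefficients of the D_i after summation by parts are the jumps of the
weights, which r_n adds up. *)
Lemma abel_summation_le a D n M : (0 < n)%N -> D 0%N = 0 ->
  (forall i, (1 <= i <= n)%N -> `|D i| <= M) ->
  `|\sum_(1 <= i < n.+1) a i * (D i - D i.-1)| <= r_ a n * M.
Proof.
case: n => // n _ D0 DM; rewrite abel_summation// /r_ mulrDl.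
apply: le_trans (ler_normB _ _) _; apply: lerD.
  by rewrite normrM ler_wpM2l// DM//= leqnn.
rewrite mulr_suml; apply: le_trans (ler_norm_sum _ _ _) _.
rewrite !big_nat; apply: ler_sum => i /andP[i1 i2]; rewrite normrM ler_wpM2l// DM//.
by case: i i1 i2 => // i i1 i2; rewrite -ltnS i1 /= ltnW.
Qed.

Lemma r__ge0 a n : 0 <= r_ a n.
Proof. by rewrite addr_ge0// sumr_ge0. Qed.

Lemma Delta_ge0 n : 0 <= Delta n :> R.
Proof.
rewrite mulr_ge0 ?powR_ge0//; case: n => [|n]; first by rewrite ln0.
by rewrite ln_ge0// ler1n.
Qed.

Lemma Delta_gt0 n : (1 < n)%N -> 0 < Delta n :> R.
Proof.
move=> n1; rewrite mulr_gt0 ?powR_gt0 ?ltr0n ?(ltn_trans _ n1)//.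
by rewrite ln_gt0// ltr1n.
Qed.

End weights.

Section weighted_sums.
Context {R : realType} d (T : measurableType d).

Definition weighted_sum (a : nat -> R) (X : nat -> T -> R) (n : nat) (w : T)
    : R :=
  \sum_(1 <= i < n.+1) a i * X i w.

Lemma measurable_weighted_sum a X n : (forall i, measurable_fun setT (X i)) ->
  measurable_fun setT (weighted_sum a X n).
Proof. by move=> mX; apply: measurable_sum => i; exact: measurable_funM. Qed.

End weighted_sums.

Lemma same_law_weighted_sum {R : realType}
  d (T : measurableType d) (P : probability T R)
  d' (T' : measurableType d') (P' : probability T' R)
  (e : nat -> {RV P >-> R}) (e' : nat -> {RV P' >-> R}) (g : R -> R)
  (a : nat -> R) (n : nat) (A : set R) :
  measurable_fun setT g -> same_law e e' -> measurable A ->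
  P [set w | A (weighted_sum a (fun i => g \o e i) n w)] =
  P' [set w | A (weighted_sum a (fun i => g \o e' i) n w)].
Proof.
move=> mg ee' mA.
pose f (t : n.-tuple R) := \sum_(i < n) a i.+1 * g (tnth t i).
have mf : measurable_fun setT f.
  apply: measurable_sum => i; apply: measurable_funM => //.
  by apply: measurableT_comp => //; exact: measurable_tnth.
have mfA : measurable (f @^-1` A) by rewrite -[X in measurable X]setTI; exact: mf.
have := ee' n _ mfA.
have fE d0 (T0 : measurableType d0) (P0 : probability T0 R)
    (X : nat -> {RV P0 >-> R}) :
    [set w | (f @^-1` A) [tuple X i.+1 w | i < n]] =
    [set w | A (weighted_sum a (fun i => g \o X i) n w)].
  apply/funext => w /=; congr (A _).
  rewrite /weighted_sum big_add1/= big_mkord.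
  by apply: eq_bigr => i _; rewrite tnth_mktuple.
by rewrite !fE.
Qed.

Section scaling.
Context {R : realType}.
Implicit Types (s : nat -> R) (c : R).

Lemma r_scale s c n : 0 <= c -> r_ (fun i => s i * c) n = r_ s n * c.
Proof.
move=> c0; rewrite /r_ mulrDl normrM (ger0_norm c0) mulr_suml; congr (_ + _).
by apply: eq_bigr => i _; rewrite -mulrBl normrM (ger0_norm c0).
Qed.

Lemma Sigma_scale s c n : 0 <= c -> Sigma (fun i => s i * c) n = Sigma s n * c.
Proof.
move=> c0; rewrite /Sigma /Sigma2.
under eq_bigr do rewrite exprMn.
rewrite -big_distrl/= sqrtrM ?sumr_ge0// ?sqrtr_sqr ?ger0_norm// => i _.
exact: sqr_ge0.
Qed.

Lemma Sigma_sqr s n : Sigma (fun i => s i ^+ 2) n = Sigma_star2 s n.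
Proof. by rewrite /Sigma /Sigma2; under eq_bigr do rewrite -exprM. Qed.

Lemma Sigma2_gt0 s n : (0 < n)%N -> (forall i, (1 <= i <= n)%N -> 0 < s i) ->
  0 < Sigma2 s n.
Proof.
case: n => // n _ s0; rewrite /Sigma2 big_nat_recr//=.
rewrite ltr_wpDl ?exprn_gt0 ?s0 ?leqnn//.
by apply: sumr_ge0 => i _; exact: sqr_ge0.
Qed.

Lemma Sigma_gt0 s n : (0 < n)%N -> (forall i, (1 <= i <= n)%N -> 0 < s i) ->
  0 < Sigma s n.
Proof. by move=> n0 s0; rewrite sqrtr_gt0 Sigma2_gt0. Qed.

Lemma sum_sqr_centered (x : nat -> R) n : (0 < n)%N ->
  \sum_(1 <= i < n.+1) (x i - (\sum_(1 <= j < n.+1) x j) / n%:R) ^+ 2 =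
  \sum_(1 <= i < n.+1) x i ^+ 2 - (\sum_(1 <= i < n.+1) x i) ^+ 2 / n%:R.
Proof.
move=> n0; set S := \sum_(1 <= j < n.+1) x j; set m := S / n%:R.
have -> : \sum_(1 <= i < n.+1) (x i - m) ^+ 2 =
    \sum_(1 <= i < n.+1) (x i ^+ 2 + (x i * (- m *+ 2) + m ^+ 2)).
  by apply: eq_bigr => i _; ring.
rewrite !big_split/= sumr_const_nat subSS subn0 -mulr_suml -/S -(mulr_natr _ n).
by rewrite /m; field; rewrite pnatr_eq0 -lt0n.
Qed.

End scaling.

Section invariance_principle.
Context {R : realType} d (T : measurableType d) (P : probability T R).
Variables (e : nat -> {RV P >-> R}) (g : R -> R) (tau : R).
Hypotheses (mg : measurable_fun setT g)
  (sip : strong_invariance_principle e g tau Delta).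
Variable a : nat -> nat -> R.
Hypotheses (a_gt0 : forall n i, (1 <= i <= n)%N -> 0 < a n i)
  (ra : r_ (a n) n * Delta n @[n --> \oo] --> (0 : R)).

Let sum_e n := weighted_sum (a n) (fun i => g \o e i) n.

(** Summation by parts turns the weighted sum of the g(e'_i) - tau (B_i - B_(i-1))
into a combination of the differences sum_(j <= i) g(e'_j) - tau B_i, whose
size is at most r_n times their maximum. Hence the strong invariance principle
gives an error o(r_n Delta_n), which tends to 0. *)
Lemma gaussian_approximation : exists (d' : measure_display)
    (T' : measurableType d') (P' : probability T' R)
    (e' : nat -> {RV P' >-> R}) (Z : nat -> T' -> R),
  [/\ same_law e e', forall n, measurable_fun setT (Z n),
      (forall n A, (0 < n)%N -> measurable A ->
        P' [set w | A (Z n w)] = normal_prob 0 (Sigma (a n) n) A) &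
      forall eps : R, 0 < eps -> vanishing P' (fun n =>
        [set w | eps <=
          `|weighted_sum (a n) (fun i => g \o e' i) n w - tau * Z n w|])].
Proof.
have [d' [T' [P' [e' [B [ee' BB SB]]]]]] := sip.
pose Z n w := weighted_sum (a n) (fun i w => B i%:R w - B i.-1%:R w) n w.
have mZ n : measurable_fun setT (Z n).
  by apply: measurable_weighted_sum => i; exact: measurable_funB.
exists d', T', P', e', Z; split => //.
  move=> n A n0 mA.
  have := @brownian_weighted_sum_law R _ _ P' B BB (fun i => a n i.+1) n A n0
    _ mA.
  have -> : Num.sqrt (\sum_(i < n) a n i.+1 ^+ 2) = Sigma (a n) n.
    by rewrite /Sigma /Sigma2 big_add1 big_mkord.
  move=> <-; last by move=> i ni; exact: a_gt0.
  congr (P' _); apply/funext => w /=.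
  by rewrite /Z /weighted_sum big_add1 big_mkord.
apply: ae_cvg0_vanishing.
  move=> n; apply: measurable_funB; last exact: measurable_funM.
  by apply: measurable_weighted_sum => i; exact: measurableT_comp.
have [B0 _ _ _] := BB.
apply: filterS2 B0 SB => w B0 SB.
pose D i := partial_sum (fun j => g \o e' j) i w - tau * B i%:R w.
pose M n := \big[Num.max/0]_(1 <= i < n.+1) `|D i|.
have D0 : D 0%N = 0 by rewrite /D /partial_sum big_geq// B0 mulr0 subr0.
have fE n : weighted_sum (a n) (fun i => g \o e' i) n w - tau * Z n w =
    \sum_(1 <= i < n.+1) a n i * (D i - D i.-1).
  rewrite /Z /weighted_sum mulr_sumr -sumrB !big_nat; apply: eq_bigr => i /andP[i1 _].
  by case: i i1 => // i _; rewrite /D /partial_sum big_nat_recr//= /comp; ring.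
have lim0 : (r_ (a n) n * Delta n) * (M n / Delta n) @[n --> \oo] --> (0 : R).
  by rewrite -(mulr0 0); apply: (cvgM ra); exact: SB.
apply/cvgr0Pnorm_lt => eps eps0.
have := lim0; move=> /cvgr0Pnorm_lt/(_ _ eps0) lime.
near=> n.
(* Delta vanishes at 0 and 1 *)
have n1 : (1 < n)%N by near: n; exists 2%N.
rewrite fE; apply: le_lt_trans (abel_summation_le (M := M n) _ _ D0 _) _.
- exact: ltn_trans n1.
- move=> i /andP[i1 ni]; rewrite /M.
  apply: (@le_bigmax_seq _ _ _ (index_iota 1 n.+1) 0 i xpredT
    (fun j => `|D j|)) => //.
  by rewrite mem_index_iota i1.
- have : `|(r_ (a n) n * Delta n) * (M n / Delta n)| < eps by near: n.
  have -> : r_ (a n) n * Delta n * (M n / Delta n) = r_ (a n) n * M n.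
    by field; rewrite gt_eqF// Delta_gt0.
  by apply: le_lt_trans; rewrite ler_norm.
Unshelve. all: by end_near. Qed.

Let measurable_sum_e n : measurable_fun setT (sum_e n).
Proof. by apply: measurable_weighted_sum => i; exact: measurableT_comp. Qed.

(** With unit-norm weights the approximating variable tau Z_n is exactly
N(0, tau^2). *)
Lemma weighted_clt : 0 < tau -> (forall n, (0 < n)%N -> Sigma (a n) n = 1) ->
  forall x, fine (P [set w | sum_e n w <= x]) @[n --> \oo] --> normal_cdf tau x.
Proof.
move=> tau0 a1 x.
have [d' [T' [P' [e' [Z [ee' mZ ZN sumZ]]]]]] := gaussian_approximation.
have mse' n : measurable_fun setT (weighted_sum (a n) (fun i => g \o e' i) n).
  by apply: measurable_weighted_sum => i; exact: measurableT_comp.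
have -> : (fun n => fine (P [set w | sum_e n w <= x])) =
    (fun n => fine (P' [set w |
      weighted_sum (a n) (fun i => g \o e' i) n w <= x])).
  apply/funext => n; congr fine.
  have itvE (S : Type) (f : S -> R) :
      [set w | f w <= x] = [set w | `]-oo, x]%classic (f w)].
    by apply/funext => w /=; rewrite in_itv.
  rewrite (itvE _ (sum_e n)).
  rewrite (itvE _ (weighted_sum (a n) (fun i => g \o e' i) n)).
  exact: (same_law_weighted_sum (a n) n mg ee' (measurable_itv _)).
apply: (@squeeze_probability _ _ _ P' (fun n w => tau * Z n w)).
- by move=> n; exact: measurable_set_le.
- by move=> n; exact: measurable_funM.
- by apply: continuous_normal_cdf; rewrite gt_eqF.
- move=> y; apply: cvg_near_cst; near=> n.
  have n0 : (0 < n)%N by near: n; exists 1%N.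
  have myt : measurable [set z : R | tau * z <= y].
    by apply: measurable_set_le => //; exact: measurable_funM.
  have -> := ZN n _ n0 myt.
  have := @normal_prob_scale R tau 1 `]-oo, y]%classic
    (lt0r_neq0 tau0) (oner_neq0 R) (measurable_itv _).
  rewrite (gtr0_norm tau0) [tau * 1]mulr1 (a1 n n0) /normal_cdf => <-.
  suff -> : [set z : R | tau * z <= y] =
    [set z | `]-oo, y]%classic (tau * z)] by [].
  by apply/funext => z /=; rewrite in_itv.
- move=> eps eps0; exists (fun n => [set w |
    eps <= `|weighted_sum (a n) (fun i => g \o e' i) n w - tau * Z n w|]).
    exact: sumZ.
  near=> n => w /= /negP; rewrite -ltNge ltr_norml => /andP[h1 h2].
  by split; lra.
Unshelve. all: by end_near. Qed.

(** The approximating variable Z_n is N(0, Sigma_n^2) with Sigma_n -> 0. *)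
Lemma weighted_lln : Sigma (a n) n @[n --> \oo] --> (0 : R) ->
  forall eps : R, 0 < eps ->
    vanishing P (fun n => [set w | eps <= `|sum_e n w|]).
Proof.
move=> a0 eps eps0.
have [d' [T' [P' [e' [Z [ee' mZ ZN sumZ]]]]]] := gaussian_approximation.
have mse' n : measurable_fun setT (weighted_sum (a n) (fun i => g \o e' i) n).
  by apply: measurable_weighted_sum => i; exact: measurableT_comp.
have mge c : measurable [set z : R | c <= `|z|] by exact: measurable_set_ge_norm.
suff [mV V0] : vanishing P' (fun n =>
    [set w | eps <= `|weighted_sum (a n) (fun i => g \o e' i) n w|]).
  split; first by move=> n; exact: measurable_set_ge_norm.
  suff <- : (fun n => fine (P' [set w |
        eps <= `|weighted_sum (a n) (fun i => g \o e' i) n w|])) =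
      (fun n => fine (P [set w | eps <= `|sum_e n w|])) by [].
  apply/funext => n; congr fine; apply/esym.
  exact: (@same_law_weighted_sum R _ _ P _ _ P' e e' g (a n) n
    [set z | eps <= `|z|] mg ee' (mge eps)).
(* + 1 because tau may be 0 *)
pose c := eps / 2 / (`|tau| + 1).
have t1 : 0 < `|tau| + 1 by rewrite ltr_wpDl.
have c0 : 0 < c by rewrite !divr_gt0.
apply: (@vanishing_sub _ _ _ P' (fun n =>
   [set w | eps / 2 <=
     `|weighted_sum (a n) (fun i => g \o e' i) n w - tau * Z n w|]
   `|` [set w | c <= `|Z n w|])).
- by move=> n; exact: measurable_set_ge_norm.
- near=> n => w /= h; apply/orP; rewrite -implyNb; apply/implyP.
  rewrite -ltNge => h'.
  have tZ : eps / 2 <= `|tau| * `|Z n w|.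
    have := ler_normD
      (weighted_sum (a n) (fun i => g \o e' i) n w - tau * Z n w) (tau * Z n w).
    by rewrite subrK normrM; lra.
  rewrite /c ler_pdivrMr// (le_trans tZ)// mulrC ler_wpM2l// lerDl.
  exact: ler01.
- apply: vanishingU; first by apply: sumZ; rewrite divr_gt0.
  split; first by move=> n; exact: measurable_set_ge_norm.
  have s_gt0 n : (0 < n)%N -> 0 < Sigma (a n) n.
    by move=> n0; apply: Sigma_gt0 => // i; exact: a_gt0.
  have lim0 : 2 * normal_cdf 1 (- (c / Sigma (a n) n)) @[n --> \oo] --> (0 : R).
    rewrite -(mulr0 2); apply: cvgMr.
    apply: (cvg_comp _ _ _ (normal_cdf_cvgNy 1)).
    apply/cvgNrNy/gtr0_cvgV0.
      by near=> n; rewrite divr_gt0// s_gt0//; near: n; exists 1%N.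
    have lim_div : Sigma (a n) n / c @[n --> \oo] --> (0 : R).
      by rewrite -(mul0r c^-1); exact: cvgMl.
    by apply: cvg_trans lim_div; apply: near_eq_cvg; near=> n; rewrite /= [RHS]invf_div.
  apply: (squeeze_cvgr _ (cvg_cst 0) lim0); near=> n.
  have n0 : (0 < n)%N by near: n; exists 1%N.
  rewrite fine_ge0//=.
  have -> := ZN n _ n0 (mge c).
  apply: le_trans (normal_tail_le _ _) _; first by rewrite gt_eqF// s_gt0.
  rewrite -[X in normal_cdf X _]mulr1.
  have -> : - c = Sigma (a n) n * (- (c / Sigma (a n) n)).
    by rewrite mulrN mulrC divfK// gt_eqF// s_gt0.
  by rewrite normal_cdf_scale// s_gt0.
Unshelve. all: by end_near. Qed.

End invariance_principle.

(** * The rate conditions *)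

Section rates.
Context {R : realType}.
Implicit Types (x y : nat -> R).

Lemma cvg0_le x y : (forall n, 0 <= x n <= y n) ->
  y n @[n --> \oo] --> (0 : R) -> x n @[n --> \oo] --> (0 : R).
Proof.
by move=> xy y0; apply: (squeeze_cvgr _ (cvg_cst 0) y0); near=> n; exact: xy.
Unshelve. all: by end_near. Qed.

Lemma cvg0_invsqrt : (Num.sqrt n%:R)^-1 @[n --> \oo] --> (0 : R).
Proof.
apply/cvgr0Pnorm_lt => eps eps0; near=> n.
have n0 : 0 < n%:R :> R by rewrite ltr0n; near: n; exists 1%N.
have nbig : (eps ^-1) ^+ 2 < n%:R by near: n; exact: nbhs_infty_gtr.
rewrite ger0_norm ?invr_ge0 ?sqrtr_ge0// invf_plt ?posrE ?sqrtr_gt0//.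
rewrite -(ger0_norm (_ : 0 <= eps^-1)) ?invr_ge0 ?(ltW eps0)//.
by rewrite -sqrtr_sqr ltr_sqrt.
Unshelve. all: by end_near. Qed.

Context (s : nat -> nat -> R).
Hypothesis delta0 : delta (s n) n @[n --> \oo] --> (0 : R).

Let term_ge0 (s' : nat -> R) n : [/\ 0 <= r_ s' n * Delta n / Sigma s' n,
  0 <= r_star s' n * Delta n / Sigma2 s' n & 0 <= Sigma_star2 s' n / Sigma2 s' n].
Proof.
have S20 : 0 <= Sigma2 s' n by apply: sumr_ge0 => i _; exact: sqr_ge0.
have r1 := r__ge0 s' n; have D0 := @Delta_ge0 R n.
have r2 : 0 <= r_star s' n := r__ge0 (fun i => s' i ^+ 2) n.
by split; apply: divr_ge0; rewrite ?sqrtr_ge0// mulr_ge0.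
Qed.

Lemma delta_r_cvg0 :
  r_ (s n) n * Delta n / Sigma (s n) n @[n --> \oo] --> (0 : R).
Proof.
apply: cvg0_le delta0 => n; have [h1 h2 h3] := term_ge0 (s n) n.
by rewrite h1 /delta lerDl [(_ + Sigma_star2 _ _) * _]mulrDl addr_ge0.
Qed.

Lemma delta_r_star_cvg0 :
  r_star (s n) n * Delta n / Sigma2 (s n) n @[n --> \oo] --> (0 : R).
Proof.
apply: cvg0_le delta0 => n; have [h1 h2 h3] := term_ge0 (s n) n.
by rewrite h2 /delta [(_ + Sigma_star2 _ _) * _]mulrDl addrCA lerDl addr_ge0.
Qed.

Lemma delta_Sigma_star_cvg0 :
  Sigma_star2 (s n) n / Sigma2 (s n) n @[n --> \oo] --> (0 : R).
Proof.
apply: cvg0_le delta0 => n; have [h1 h2 h3] := term_ge0 (s n) n.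
by rewrite h3 /delta [(_ + Sigma_star2 _ _) * _]mulrDl addrA lerDr addr_ge0.
Qed.

End rates.

(** * The pivot and the confidence interval *)

Section modulated_statistics.
Context {R : realType} d (T : measurableType d) (P : probability T R).
Context (e : nat -> {RV P >-> R}) (mu : R) (s : nat -> R) (n : nat).
Hypotheses (n_gt0 : (0 < n)%N) (s_gt0 : forall i, (1 <= i <= n)%N -> 0 < s i).

Let X := fun i => modulated mu s e i : {RV P >-> R}.

(** Written with [id \o e i] to match the partial sums in the strong invariance
principle for [e]. *)
Definition standardized_error : T -> R :=
  weighted_sum (fun i => s i / Sigma s n) (fun i => id \o e i) n.

Let square_deviation (w : T) : R :=
  weighted_sum (fun i => s i ^+ 2 / Sigma2 s n)
    (fun i => centered_square \o e i) n w.

Let scaled_error (w : T) : R :=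
  weighted_sum (fun i => s i / (Sigma s n * Num.sqrt n%:R))
    (fun i => id \o e i) n w.

Definition studentizer (w : T) : R := V_ X n w / Sigma s n.

Let S0 : 0 < Sigma s n. Proof. exact: Sigma_gt0. Qed.

Lemma sum_standardized_error w :
  \sum_(1 <= i < n.+1) s i * e i w = standardized_error w * Sigma s n.
Proof.
rewrite /standardized_error /weighted_sum mulr_suml.
apply: eq_bigr => i _ /=.
by field; rewrite gt_eqF.
Qed.

Lemma sample_mean_error w :
  sample_mean X n w - mu = standardized_error w * Sigma s n / n%:R.
Proof.
rewrite -sum_standardized_error /sample_mean /= /modulated big_split/=.
rewrite sumr_const_nat subSS subn0.
by rewrite -(mulr_natr mu); field; rewrite pnatr_eq0 -lt0n.
Qed.

Lemma pivotE w : pivot mu X n w = standardized_error w / studentizer w.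
Proof.
rewrite /pivot sample_mean_error /studentizer invf_div.
rewrite [RHS]mulrA; congr (_ / _).
by field; rewrite pnatr_eq0 -lt0n.
Qed.

Lemma studentizer_ge0 w : 0 <= studentizer w.
Proof. by rewrite divr_ge0 ?sqrtr_ge0. Qed.

(** V_n^2 is the sum of the (sigma_i e_i)^2 minus the square of the sum of the
sigma_i e_i over n; dividing by Sigma_n^2 and writing e_i^2 as 1 + (e_i^2 - 1)
leaves 1 and two error terms. *)
Lemma studentizer_sqr w :
  studentizer w ^+ 2 = 1 + square_deviation w - scaled_error w ^+ 2.
Proof.
have S20 := Sigma2_gt0 n_gt0 s_gt0.
have n0 : 0 < n%:R :> R by rewrite ltr0n.
have SS : Sigma s n ^+ 2 = Sigma2 s n by rewrite sqr_sqrtr ?ltW.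
have -> : scaled_error w =
    (\sum_(1 <= i < n.+1) s i * e i w) / (Sigma s n * Num.sqrt n%:R).
  by rewrite mulr_suml; apply: eq_bigr => i _ /=; rewrite mulrAC.
have -> : square_deviation w =
    (\sum_(1 <= i < n.+1) (s i * e i w) ^+ 2) / Sigma2 s n - 1.
  rewrite -(divff (lt0r_neq0 S20)) -mulrBl /Sigma2 -sumrB mulr_suml.
  by apply: eq_bigr => i _; rewrite /= /centered_square; ring.
rewrite /studentizer expr_div_n SS sqr_sqrtr; last first.
  by apply: sumr_ge0 => i _; exact: sqr_ge0.
have -> : \sum_(1 <= i < n.+1) (X i w - sample_mean X n w) ^+ 2 =
    \sum_(1 <= i < n.+1)
      (s i * e i w - (\sum_(1 <= j < n.+1) s j * e j w) / n%:R) ^+ 2.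
  apply: eq_bigr => i _; congr (_ ^+ 2).
  have := sample_mean_error w; rewrite -sum_standardized_error => <-.
  by rewrite /X /= /modulated; ring.
rewrite sum_sqr_centered// expr_div_n exprMn SS sqr_sqrtr ?ltW//.
by field; rewrite !gt_eqF.
Qed.

(** For x >= 0, |x - 1| <= |x^2 - 1|. *)
Lemma studentizer_near1 w (eps : R) :
  `|square_deviation w| < eps / 2 ->
  `|scaled_error w| < Num.min 1 (eps / 2) ->
  `|studentizer w - 1| < eps.
Proof.
have := studentizer_sqr w.
set a := square_deviation w; set b := scaled_error w.
move=> QE aeps; rewrite lt_min => /andP[b1 beps].
have Q0 := studentizer_ge0 w.
apply: (@le_lt_trans _ _ `|studentizer w ^+ 2 - 1|).
  have -> : studentizer w ^+ 2 - 1 = (studentizer w - 1) * (studentizer w + 1).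
    by ring.
  by rewrite normrM ler_peMr// ger0_norm ?addr_ge0// lerDr.
rewrite QE (_ : 1 + a - b ^+ 2 - 1 = a - b ^+ 2); last by ring.
apply: le_lt_trans (ler_normB _ _) _; rewrite normrX (splitr eps) ltrD//.
by apply: le_lt_trans beps; rewrite expr2 ler_piMr// ltW.
Qed.

(** Unlike the pivot, this form does not divide by V_n. *)
Lemma mem_confidence_interval z (tau_hat : T -> R) w :
  (mu \in confidence_interval z tau_hat X n w) =
  (`|standardized_error w| <= z * tau_hat w * studentizer w).
Proof.
have n0 : 0 < n%:R :> R by rewrite ltr0n.
rewrite /confidence_interval in_itv/=; set h := _ / n%:R.
have -> : (sample_mean X n w - h <= mu) = (sample_mean X n w - mu <= h).
  by rewrite !lerBlDr addrC.
have -> : (mu <= sample_mean X n w + h) = (- h <= sample_mean X n w - mu).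
  by rewrite lerBrDr (addrC (- h)) lerBlDr.
have -> : h = z * tau_hat w * studentizer w * (Sigma s n / n%:R).
  by rewrite /h /studentizer; field; rewrite !gt_eqF.
rewrite sample_mean_error -mulrA -mulNr !ler_pM2r ?divr_gt0//.
by rewrite ler_norml andbC.
Qed.

End modulated_statistics.

Theorem proposition2p2 (R : realType) (d : measure_display)
  (T : measurableType d) (P : probability T R)
  (e : nat -> {RV P >-> R}) (mu : R) (sigma : nat -> nat -> R) :
  let e_star := fun i => centered_square \o e i in
  let tau := Num.sqrt (long_run_variance P e) in
  let tau_star := Num.sqrt (long_run_variance P e_star) in
  let X := fun n i => modulated mu (sigma n) e i : {RV P >-> R} in
  stationary e ->
  (forall i, (0 < i)%N -> ('E_P[e i] = 0)%E) ->
  (forall i, (0 < i)%N -> ('E_P[fun w => (e i w ^+ 2)%R] = 1)%E) ->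
  (forall n i, (1 <= i <= n)%N -> 0 < sigma n i) ->
  long_run_variance_defined P e ->
  long_run_variance_defined P e_star ->
  0 < long_run_variance P e ->
  strong_invariance_principle e id tau Delta ->
  strong_invariance_principle e centered_square tau_star Delta ->
  delta (sigma n) n @[n --> \oo] --> (0 : R) ->
  cvg_in_distribution (fun n => pivot mu (X n) n : {RV P >-> R})
    (normal_prob 0 tau)
  /\
  (forall (tau_hat : nat -> {RV P >-> R}) (alpha : R),
    cvg_in_probability tau_hat tau ->
    0 < alpha < 1 ->
    let z := quantile (normal_prob 0 1) (1 - alpha / 2) in
    P [set w | mu \in confidence_interval z (tau_hat n) (X n) n w]
      @[n --> \oo] --> (1 - alpha)%:E).
Proof.
move=> e_star tau tau_star X _ _ _ s_gt0 _ _ lrv_gt0 sip sip_star delta0.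
have tau_gt0 : 0 < tau by rewrite sqrtr_gt0.
have tau_neq0 : tau != 0 by rewrite gt_eqF.
pose W n := standardized_error e (sigma n) n.
pose Q n := studentizer e mu (sigma n) n.
have mcs : measurable_fun setT (@centered_square R).
  by apply: measurable_funB => //; exact: exprn_measurable.
have mW n : measurable_fun setT (W n).
  by apply: measurable_weighted_sum => i; exact: measurableT_comp.
have mQ n : measurable_fun setT (Q n).
  by apply: measurable_funM.
have r_cvg0 := delta_r_cvg0 delta0.
have Sigma_ge0 n : 0 <= (Sigma (sigma n) n)^-1 by rewrite invr_ge0 sqrtr_ge0.
(* weights of unit norm: the numerator of the pivot is asymptotically normal *)
have Wcvg x : fine (P [set w | W n w <= x]) @[n --> \oo] --> normal_cdf tau x.
  apply: (weighted_clt (@measurable_id _ _ _) sip) => //.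
  - move=> n i /[dup] /s_gt0 si /andP[i1 ni].
    by rewrite divr_gt0// Sigma_gt0 ?(leq_trans i1)// => j /s_gt0.
  - apply: cvg_trans r_cvg0; apply: near_eq_cvg; near=> n.
    by rewrite r_scale// mulrAC.
  - move=> n n0; by rewrite Sigma_scale// divff// gt_eqF// Sigma_gt0// => j /s_gt0.
(* the two error terms of the squared studentizer are weighted sums whose weights
   have norms Sigma_star2 / Sigma2 and 1 / sqrt n *)
have Qcvg eps : 0 < eps ->
    vanishing P (fun n => [set w | eps <= `|Q n w - 1|]).
  move=> eps0.
  apply: (@vanishing_sub _ _ _ P (fun n =>
    [set w | eps / 2 <=
      `|weighted_sum (fun i => sigma n i ^+ 2 / Sigma2 (sigma n) n)
          (fun i => centered_square \o e i) n w|] `|`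
    [set w | Num.min 1 (eps / 2) <=
      `|weighted_sum (fun i => sigma n i / (Sigma (sigma n) n * Num.sqrt n%:R))
          (fun i => id \o e i) n w|])).
  - by move=> n; apply: measurable_set_ge_norm; exact: measurable_funB.
  - near=> n => w /= h; have n0 : (0 < n)%N by near: n; exists 1%N.
    apply/orP; rewrite -implyNb; apply/implyP; rewrite -ltNge => h1.
    rewrite leNgt; apply/negP => h2.
    have := studentizer_near1 mu n0 (s_gt0 n) h1 h2.
    by rewrite ltNge h.
  - apply: vanishingU.
    + apply: (weighted_lln mcs sip_star).
      * move=> n i /[dup] /s_gt0 si /andP[i1 ni].
        rewrite divr_gt0 ?exprn_gt0// Sigma2_gt0 ?(leq_trans i1)// => j.
        by move/s_gt0.
      * apply: cvg_trans (delta_r_star_cvg0 delta0).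
        apply: near_eq_cvg; near=> n.
        have -> : r_star (sigma n) n = r_ (fun i => sigma n i ^+ 2) n by [].
        rewrite r_scale ?invr_ge0 ?sumr_ge0// => [|i _]; last exact: sqr_ge0.
        by rewrite mulrAC.
      * apply: cvg_trans (delta_Sigma_star_cvg0 delta0).
        apply: near_eq_cvg; near=> n.
        rewrite Sigma_scale ?Sigma_sqr// invr_ge0 sumr_ge0// => i _.
        exact: sqr_ge0.
      * by rewrite divr_gt0.
    + have sqrt_ge0 n : 0 <= (Sigma (sigma n) n * Num.sqrt n%:R)^-1.
        by rewrite invr_ge0 mulr_ge0 ?sqrtr_ge0.
      apply: (weighted_lln (@measurable_id _ _ _) sip).
      * move=> n i /[dup] /s_gt0 si /andP[i1 ni]; have n0 := leq_trans i1 ni.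
        by rewrite divr_gt0// mulr_gt0 ?Sigma_gt0 ?sqrtr_gt0 ?ltr0n// => j /s_gt0.
      * have : r_ (sigma n) n * Delta n / Sigma (sigma n) n
            * (Num.sqrt n%:R)^-1 @[n --> \oo] --> (0 : R).
          by rewrite -(mulr0 0); exact: cvgM r_cvg0 cvg0_invsqrt.
        apply: cvg_trans; apply: near_eq_cvg; near=> n.
        by rewrite r_scale// invfM; ring.
      * apply: cvg_trans (@cvg0_invsqrt R); apply: near_eq_cvg; near=> n.
        have n0 : (0 < n)%N by near: n; exists 1%N.
        rewrite Sigma_scale// invfM mulrA divff ?mul1r// gt_eqF//.
        by rewrite Sigma_gt0// => j /s_gt0.
      * by rewrite lt_min ltr01 divr_gt0.
split.
  move=> x _; rewrite [X in _ --> X](normal_cdfE tau x).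
  have -> : (fun n => cdf (pivot mu (X n) n : {RV P >-> R}) x) =
      (fun n => P [set w | pivot mu (X n) n w <= x]).
    apply/funext => n; rewrite /cdf /distribution /pushforward.
    suff -> : pivot mu (X n) n @^-1` `]-oo, x]%classic =
      [set w | pivot mu (X n) n w <= x] by [].
    by apply/seteqP; split => w /=; rewrite in_itv.
  have mpiv n : measurable [set w | pivot mu (X n) n w <= x].
    exact: (measurable_set_le
      (measurable_funPT (pivot mu (X n) n : {RV P >-> R})) (measurable_cst x)).
  apply/(cvg_fine_probability P) => //.
  apply: (@squeeze_probability _ _ _ P W) => //; first exact: continuous_normal_cdf.
  (* within 1 / 2 of 1 the studentizer is positive; the other bound makes
     x * (Q - 1) at most eps *)
  move=> eps eps0; pose eta := Num.min (1 / 2) (eps / (`|x| + 1)).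
  have x1 : 0 < `|x| + 1 by rewrite ltr_wpDl.
  have eta0 : 0 < eta by rewrite lt_min !divr_gt0.
  exists (fun n => [set w | eta <= `|Q n w - 1|]); first exact: Qcvg.
  near=> n => w /= /negP; rewrite -ltNge => Qeta.
  have n0 : (0 < n)%N by near: n; exists 1%N.
  rewrite (pivotE e mu n0 (s_gt0 n)) -/(W n w) -/(Q n w).
  have Qpos : 0 < Q n w.
    have : `|Q n w - 1| < 1 / 2.
      by apply: lt_le_trans Qeta _; rewrite ge_min lexx.
    by rewrite ltr_norml => /andP[h _]; lra.
  have xQ : `|x * (Q n w - 1)| <= eps.
    rewrite normrM; apply: (@le_trans _ _ ((`|x| + 1) * eta)).
      by apply: ler_pM => //; [rewrite lerDl|exact: ltW].
    by rewrite mulrC -ler_pdivlMr// ge_min lexx orbT.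
  rewrite ler_pdivrMr//; move: xQ; rewrite mulrBr mulr1 ler_norml => /andP[h1 h2].
  by split; lra.
move=> tau_hat alpha tau_hatP /andP[al0 al1] z.
have p01 : 0 < 1 - alpha / 2 < 1 by apply/andP; split; lra.
have cdfz : normal_cdf 1 z = 1 - alpha / 2.
  exact: normal_cdf_quantile (oner_neq0 R) p01.
(* by symmetry the standard normal distribution function is 1 / 2 at 0 *)
have z_ge0 : 0 <= z.
  rewrite leNgt; apply/negP => /ltW/(normal_cdf_le 1); rewrite cdfz => zle.
  by have := @normal_cdfN R 1 0 (oner_neq0 R); rewrite oppr0; lra.
pose U n w := z * tau_hat n w * Q n w.
have mU n : measurable_fun setT (U n).
  by apply: measurable_funM => //; exact: measurable_funM.
have tau_hatV eta : 0 < eta ->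
    vanishing P (fun n => [set w | eta <= `|tau_hat n w - tau|]).
  move=> eta0.
  have mE n : measurable [set w | eta <= `|tau_hat n w - tau|].
    by apply: measurable_set_ge_norm; exact: measurable_funB.
  by split => //; apply/(cvg_fine_probability P) => //; exact: tau_hatP.
have Ucvg eps : 0 < eps ->
    vanishing P (fun n => [set w | eps <= `|U n w - z * tau|]).
  (* U - z tau = z ((tau_hat - tau) Q + tau (Q - 1)) with |Q| <= 2 *)
  move=> eps0; pose K := z * (2 + tau) + 1.
  have K0 : 0 < K by rewrite ltr_wpDl// mulr_ge0// addr_ge0// ltW.
  pose eta := Num.min 1 (eps / K).
  have eta0 : 0 < eta by rewrite lt_min ltr01 divr_gt0.
  apply: vanishing_sub (vanishingU (Qcvg _ eta0) (tau_hatV _ eta0)).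
    by move=> n; apply: measurable_set_ge_norm; exact: measurable_funB.
  near=> n => w /= h.
  apply/orP; rewrite -implyNb; apply/implyP; rewrite -ltNge => h1.
  rewrite leNgt; apply/negP => h2; move: h; rewrite leNgt => /negP; apply.
  have Q2 : `|Q n w| <= 2.
    have q1 : `|Q n w - 1| < 1.
      by apply: lt_le_trans h1 _; rewrite ge_min lexx.
    by have := ler_normD (Q n w - 1) 1; rewrite subrK normr1; lra.
  have -> : U n w - z * tau =
      z * ((tau_hat n w - tau) * Q n w + tau * (Q n w - 1)).
    by rewrite /U; ring.
  rewrite normrM ger0_norm//; apply: (@le_lt_trans _ _ (z * (eta * 2 + tau * eta))).
    rewrite ler_wpM2l//; apply: le_trans (ler_normD _ _) _.
    rewrite [`|(_ - tau) * _|]normrM [`|tau * _|]normrM (gtr0_norm tau_gt0).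
    by apply: lerD; [apply: ler_pM => //|rewrite ler_pM2l//]; exact: ltW.
  have : eta * K <= eps by rewrite -ler_pdivlMr// ge_min lexx orbT.
  by rewrite /K; lra.
pose CI n := [set w | mu \in confidence_interval z (tau_hat n) (X n) n w].
have mCI n : measurable (CI n).
  pose h w := z * tau_hat n w * V_ (X n) n w / n%:R.
  have mh : measurable_fun setT h.
    apply: measurable_funM => //; apply: measurable_funM => //.
    exact: measurable_funM.
  have -> : CI n = [set w | sample_mean (X n) n w - h w <= mu] `&`
      [set w | mu <= sample_mean (X n) n w + h w].
    by apply/seteqP; split => w;
      rewrite /CI /= /confidence_interval in_itv/= => /andP.
  apply: measurableI; apply: measurable_set_le => //.
    exact: measurable_funB.
  exact: measurable_funD.
apply/(cvg_fine_probability P) => //.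
have cdf_tau :
    normal_cdf tau (z * tau) - normal_cdf tau (- (z * tau)) = 1 - alpha.
  rewrite normal_cdfN// mulrC -[X in normal_cdf X _]mulr1.
  rewrite normal_cdf_scale ?oner_neq0// cdfz.
  by field.
rewrite -cdf_tau.
have mA1 n : measurable [set w | W n w <= U n w] by exact: measurable_set_le.
have mA2 n : measurable [set w | W n w < - U n w /\ W n w <= U n w].
  have mlt : measurable [set w | W n w < - U n w].
    have -> : [set w | W n w < - U n w] = ~` [set w | - U n w <= W n w].
      by apply/seteqP; split => w /=; rewrite ltNge => /negP.
    apply: measurableC; apply: measurable_set_le => //.
    exact: measurableT_comp.
  exact: measurableI mlt (mA1 n).
(* |W| <= U means W <= U but not W < - U *)
have lim1 : fine (P [set w | W n w <= U n w]) @[n --> \oo] -->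
    normal_cdf tau (z * tau).
  apply: (@squeeze_probability _ _ _ P W) => //; first exact: continuous_normal_cdf.
  move=> eps eps0; exists (fun n => [set w | eps <= `|U n w - z * tau|]).
    exact: Ucvg.
  near=> m => w /= /negP; rewrite -ltNge ltr_norml => /andP[h1 h2].
  move: (W m w) (U m w) (z * tau) h1 h2; clear=> a b c h1 h2.
  by split=> h; lra.
have lim2 : fine (P [set w | W n w < - U n w /\ W n w <= U n w]) @[n --> \oo] -->
    normal_cdf tau (- (z * tau)).
  apply: (squeeze_probability mA2 mW _ Wcvg); first exact: continuous_normal_cdf.
  move=> eps eps0; exists (fun n => [set w | eps <= `|U n w - z * tau|]).
    exact: Ucvg.
  have zt0 : 0 <= z * tau by rewrite mulr_ge0// ltW.
  near=> m => w /= /negP; rewrite -ltNge ltr_norml => /andP[h1 h2].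
  move: (W m w) (U m w) (z * tau) zt0 h1 h2; clear=> a b c zt0 h1 h2.
  by split => [h|[h h']]; [split; lra|lra].
apply: cvg_trans (cvgB lim1 lim2); apply: near_eq_cvg; near=> n.
have n0 : (0 < n)%N by near: n; exists 1%N.
transitivity (fine (P [set w | W n w <= U n w]) -
    fine (P [set w | W n w < - U n w /\ W n w <= U n w])); first by [].
have -> : [set w | W n w <= U n w] =
    CI n `|` [set w | W n w < - U n w /\ W n w <= U n w].
  apply/seteqP; split => w /=;
    rewrite /CI /= (mem_confidence_interval e mu n0 (s_gt0 n));
    rewrite -/(W n w) -/(Q n w) -/(U n w) ler_norml.
    by move=> WU; rewrite WU andbT; case: (leP (- U n w) (W n w)); [left|right].
  by case=> [/andP[]|[]].
rewrite measureU//; last first.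
  apply/seteqP; split => // w [+ [WU _]].
  rewrite /CI /= (mem_confidence_interval e mu n0 (s_gt0 n)).
  rewrite -/(W n w) -/(Q n w) -/(U n w).
  by rewrite ler_norml leNgt WU.
by rewrite fineD ?fin_num_measure// addrK.
Unshelve. all: by end_near. Qed.
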